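(* Let $\boldsymbol{A}=[\boldsymbol{a}_1,\ldots,\boldsymbol{a}_N]\in\mathbb{R}^{M\times N}$ and $\boldsymbol{S}=[\boldsymbol{s}_1,\ldots,\boldsymbol{s}_L]\in\mathbb{R}^{N\times L}$ with $N\le\min\{M,L\}$, and assume that (A1) every $\boldsymbol{s}_i$ lies in the unit simplex, i.e. $\boldsymbol{s}_i\ge\boldsymbol{0}$ and $\boldsymbol{1}^T\boldsymbol{s}_i=1$; (A2) $\boldsymbol{A}$ has full column rank; (A3) $\boldsymbol{S}$ has full row rank. Let $\boldsymbol{x}_i=\boldsymbol{A}\boldsymbol{s}_i$ for $i=1,\ldots,L$, let $\mathcal{X}=\mathrm{conv}\{\boldsymbol{x}_1,\ldots,\boldsymbol{x}_L\}$, and let $\gamma$ be the uniform pixel purity level of $\boldsymbol{s}_1,\ldots,\boldsymbol{s}_L$. Suppose that $N\ge 3$ and $\gamma>1/\sqrt{N-1}$. Then the maximum volume inscribed ellipsoid of $\mathcal{X}$, i.e. the optimal ellipsoid $\mathcal{E}(\boldsymbol{F},\boldsymbol{c})$ of the problem $$\max_{\boldsymbol{F}\in\mathbb{R}^{M\times(N-1)},\ \boldsymbol{c}\in\mathbb{R}^M}\ \det(\boldsymbol{F}^T\boldsymbol{F})\quad\text{s.t.}\quad \mathcal{E}(\boldsymbol{F},\boldsymbol{c})\subseteq\mathcal{X},$$ is (as a set) uniquely given by $$\mathcal{E}^\star=\mathcal{E}\left(\tfrac{1}{\sqrt{N(N-1)}}\boldsymbol{A}\boldsymbol{C},\ \bar{\boldsymbol{a}}\right),$$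 where $\boldsymbol{C}\in\mathbb{R}^{N\times(N-1)}$ is any semi-unitary matrix (i.e. $\boldsymbol{C}^T\boldsymbol{C}=\boldsymbol{I}$) such that $\boldsymbol{C}^T\boldsymbol{1}=\boldsymbol{0}$, and $\bar{\boldsymbol{a}}=\frac1N\sum_{i=1}^N\boldsymbol{a}_i$. Also, there are exactly $N$ contact points between $\mathcal{E}^\star$ and the relative boundary $\mathrm{rbd}\,\mathcal{X}$ of $\mathcal{X}$, that is, $$\mathcal{E}^\star\cap(\mathrm{rbd}\,\mathcal{X})=\{\boldsymbol{q}_1,\ldots,\boldsymbol{q}_N\},$$ and those contact points are given by $$\boldsymbol{q}_i=\frac{1}{N-1}\sum_{j\ne i}\boldsymbol{a}_j,\qquad i=1,\ldots,N.$$
   Context: For $\boldsymbol{F}\in\mathbb{R}^{m\times n}$ and $\boldsymbol{c}\in\mathbb{R}^m$, $\mathcal{E}(\boldsymbol{F},\boldsymbol{c})=\{\boldsymbol{F}\boldsymbol{\alpha}+\boldsymbol{c} : \boldsymbol{\alpha}\in\mathbb{R}^n,\ \|\boldsymbol{\alpha}\|\le 1\}$, where $\|\cdot\|$ is the Euclidean norm. (In the maximization problem $\boldsymbol{F}$ is not constrained to have full column rank.) $\boldsymbol{1}$ is the all-one vector, $\boldsymbol{e}_i$ the $i$-th standard unit vector of $\mathbb{R}^N$, $\boldsymbol{s}\ge\boldsymbol{0}$ means element-wise non-negative, and $\mathcal{B}_N=\{\boldsymbol{x}\in\mathbb{R}^N : \|\boldsymbol{x}\|\le1\}$. The uniform pixel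 purity level is $$\gamma=\max\{r\le1 : (\mathrm{conv}\{\boldsymbol{e}_1,\ldots,\boldsymbol{e}_N\})\cap(r\mathcal{B}_N)\subseteq\mathrm{conv}\{\boldsymbol{s}_1,\ldots,\boldsymbol{s}_L\}\}$$ (read as a supremum in degenerate cases where the maximum is not attained). *)

(* Defs.v *)
From mathcomp Require Import all_boot all_order all_algebra.
From mathcomp Require Import all_classical all_reals all_analysis.

Set Implicit Arguments.
Unset Strict Implicit.
Unset Printing Implicit Defensive.

Import Order.TTheory GRing.Theory Num.Theory.
Import numFieldNormedType.Exports.

Local Open Scope classical_set_scope.
Local Open Scope ring_scope.

(* The library's norm on ['cV_m] is the sup norm, hence this definition. *)
Definition enorm (R : realType) m (x : 'cV[R]_m) : R :=
  Num.sqrt (\sum_i x i 0 ^+ 2).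

Definition unit_ball (R : realType) m : set 'cV[R]_m :=
  [set x | enorm x <= 1].

Definition ellipsoid (R : realType) m n (F : 'M[R]_(m, n)) (c : 'cV[R]_m) :
    set 'cV[R]_m :=
  [set F *m a + c | a in @unit_ball R n].

Definition conv_hull (R : realType) m k (y : 'I_k -> 'cV[R]_m) : set 'cV[R]_m :=
  [set x | exists w : 'I_k -> R,
    [/\ forall i, 0 <= w i, \sum_i w i = 1 & x = \sum_i w i *: y i]].

Definition aff_hull (R : realType) m (X : set 'cV[R]_m) : set 'cV[R]_m :=
  [set x | exists k (y : 'I_k -> 'cV[R]_m) (w : 'I_k -> R),
    [/\ forall i, X (y i), \sum_i w i = 1 & x = \sum_i w i *: y i]].

(* Relative to the affine hull: [x] has a neighbourhood whose trace on
   [aff_hull X] is contained in [X]. *)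
Definition relint (R : realType) m (X : set 'cV[R]_m) : set 'cV[R]_m :=
  [set x | X x /\ within (aff_hull X) (nbhs x) X].

Definition rbd (R : realType) m (X : set 'cV[R]_m) : set 'cV[R]_m :=
  closure X `\` relint X.

(* The set below is bounded above by 1; it contains 0, since the
   unit simplex misses the origin. So [sup] is a genuine supremum, equal to
   the maximum whenever the maximum is attained. *)
Definition purity_level (R : realType) N L (s : 'I_L -> 'cV[R]_N) : R :=
  sup [set r : R | r <= 1 /\
    conv_hull (fun i : 'I_N => delta_mx i 0)
      `&` [set r *: x | x in @unit_ball R N] `<=` conv_hull s].

Definition mvie_optimal (R : realType) m n (X : set 'cV[R]_m)
    (F : 'M[R]_(m, n)) (c : 'cV[R]_m) : Prop :=
  ellipsoid F c `<=` X /\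
  forall (F' : 'M[R]_(m, n)) (c' : 'cV[R]_m),
    ellipsoid F' c' `<=` X -> \det (F'^T *m F') <= \det (F^T *m F).

(* Main.v *)
(* Let [H] be the matrix, in the orthonormal frame [C] of the hyperplane
   orthogonal to [1], of an ellipsoid inscribed in the simplex, with centre [d].
   Positivity of the coordinates says that the i-th row of [C H] has norm at most
   [d_i], so these norms sum to at most 1. Replacing [H] by the Cholesky factor
   [T] of [H H^T] changes neither the norms nor [|det H|], and with [u_i] the
   rows of [C], Cauchy-Schwarz gives
     [tr T = sum_i <u_i, u_i T> <= sqrt ((N-1)/N) * sum_i |u_i T|].
   [T] being triangular, AM-GM on its diagonal turns this into the bound on
   [det H]. In the equality case each [u_i] is an eigenvector of [T], whose only
   eigenvalue is the common diagonal entry, so [T] is scalar.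
   The optimal ellipsoid is the ball of radius [1/sqrt (N-1)] about the origin cut
   by the hyperplane: it lies in the simplex and meets a facet only at the centre
   of that facet. The purity assumption puts a neighbourhood of its other points
   in the convex hull of the [s_i]. *)
Require Import Defs.
From mathcomp Require Import all_boot all_order all_algebra.
From mathcomp Require Import all_classical all_reals all_analysis.
From mathcomp Require Import ring lra.

Set Implicit Arguments.
Unset Strict Implicit.
Unset Printing Implicit Defensive.

Import Order.TTheory GRing.Theory Num.Theory.
Import numFieldNormedType.Exports.

Local Open Scope classical_set_scope.
Local Open Scope ring_scope.

(** * Euclidean norm *)

Definition dotv (R : realType) n (x y : 'cV[R]_n) : R := (x^T *m y) 0 0.

Lemma dotvE (R : realType) n (x y : 'cV[R]_n) :
  dotv x y = \sum_i x i 0 * y i 0.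
Proof. by rewrite /dotv mxE; apply: eq_bigr => i _; rewrite mxE. Qed.

Lemma dotvC (R : realType) n (x y : 'cV[R]_n) : dotv x y = dotv y x.
Proof. by rewrite !dotvE; apply: eq_bigr => i _; rewrite mulrC. Qed.

Lemma dotvBr (R : realType) n (x y z : 'cV[R]_n) :
  dotv x (y - z) = dotv x y - dotv x z.
Proof. by rewrite /dotv mulmxBr !mxE. Qed.

Lemma dotvZr (R : realType) n (x y : 'cV[R]_n) a :
  dotv x (a *: y) = a * dotv x y.
Proof. by rewrite /dotv -scalemxAr mxE. Qed.

Lemma dotv_row (R : realType) m n p (P : 'M[R]_(m, n)) (Q : 'M[R]_(p, n)) i j :
  dotv (row i P)^T (row j Q)^T = (P *m Q^T) i j.
Proof. by rewrite dotvE mxE; apply: eq_bigr => k _; rewrite !mxE. Qed.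

Lemma enorm_ge0 (R : realType) n (x : 'cV[R]_n) : 0 <= enorm x.
Proof. exact: sqrtr_ge0. Qed.

Lemma sqr_enorm (R : realType) n (x : 'cV[R]_n) : enorm x ^+ 2 = dotv x x.
Proof.
rewrite sqr_sqrtr ?dotvE; first by apply: eq_bigr => i _; rewrite expr2.
by apply: sumr_ge0 => i _; rewrite sqr_ge0.
Qed.

Lemma enorm_le (R : realType) n (x : 'cV[R]_n) r :
  0 <= r -> (enorm x <= r) = (dotv x x <= r ^+ 2).
Proof. by move=> r0; rewrite -sqr_enorm ler_sqr ?nnegrE ?enorm_ge0. Qed.

Lemma enormZ (R : realType) n (x : 'cV[R]_n) a :
  enorm (a *: x) = `|a| * enorm x.
Proof.
apply/eqP; rewrite -(eqrXn2 (ltn0Sn 1)) ?enorm_ge0 ?mulr_ge0 ?enorm_ge0 //.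
by rewrite exprMn !sqr_enorm dotvZr dotvC dotvZr mulrA -expr2 real_normK ?num_real.
Qed.

Lemma enorm0 (R : realType) n : enorm (0 : 'cV[R]_n) = 0.
Proof. by rewrite -(scale0r 0) enormZ normr0 mul0r. Qed.

Lemma enorm_eq0 (R : realType) n (x : 'cV[R]_n) : (enorm x == 0) = (x == 0).
Proof.
apply/eqP/eqP => [x0|->]; last exact: enorm0.
have : dotv x x = 0 by rewrite -sqr_enorm x0 expr0n.
rewrite dotvE => /psumr_eq0P h; apply/matrixP => i j; rewrite ord1 mxE.
apply/eqP; rewrite -sqrf_eq0 expr2 h // => k _.
by rewrite -expr2 sqr_ge0.
Qed.

Lemma enorm_delta (R : realType) n (i : 'I_n) :
  enorm (delta_mx i 0 : 'cV[R]_n) = 1.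
Proof.
apply/eqP; rewrite -(eqrXn2 (ltn0Sn 1)) ?enorm_ge0 ?ler01 // sqr_enorm.
by rewrite /dotv trmx_delta mul_delta_mx mxE eqxx expr1n.
Qed.

(** One identity yields both Cauchy-Schwarz and its equality case. Cross-scaling by the norms avoids
    dividing by them. *)
Lemma sqr_enormB_scaled (R : realType) n (x y : 'cV[R]_n) :
  enorm (enorm x *: y - enorm y *: x) ^+ 2 =
  2 * (enorm x * enorm y) * (enorm x * enorm y - dotv x y).
Proof.
rewrite sqr_enorm dotvBr !dotvZr ![dotv (_ - _) _]dotvC !dotvBr !dotvZr.
rewrite -!sqr_enorm (dotvC y x); ring.
Qed.

Lemma cauchy_schwarz (R : realType) n (x y : 'cV[R]_n) :
  dotv x y <= enorm x * enorm y.
Proof.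
have [->|x0] := eqVneq x 0.
  by rewrite enorm0 mul0r /dotv trmx0 mul0mx mxE.
have [->|y0] := eqVneq y 0.
  by rewrite enorm0 mulr0 /dotv mulmx0 mxE.
have xy : 0 < 2 * (enorm x * enorm y).
  by rewrite !mulr_gt0 // lt_def enorm_eq0 ?x0 ?y0 enorm_ge0.
by rewrite -subr_ge0 -(pmulr_rge0 _ xy) -sqr_enormB_scaled sqr_ge0.
Qed.

Lemma cauchy_schwarz_eq (R : realType) n (x y : 'cV[R]_n) :
  dotv x y = enorm x * enorm y -> enorm x *: y = enorm y *: x.
Proof.
move=> e; apply/eqP; rewrite -subr_eq0 -enorm_eq0 -sqrf_eq0 sqr_enormB_scaled.
by rewrite e subrr mulr0.
Qed.

(* The minimum of a linear form over the unit ball is minus its norm. *)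
Lemma linear_ge0_unit_ball (R : realType) n (b : 'cV[R]_n) (c : R) :
  (forall a, enorm a <= 1 -> 0 <= dotv b a + c) <-> enorm b <= c.
Proof.
split=> [h|bc a a1].
  have [->|b0] := eqVneq b 0.
    have := h 0; rewrite enorm0 => /(_ ler01).
    by rewrite /dotv mulmx0 mxE add0r.
  have b1 : 0 < enorm b by rewrite lt_def enorm_eq0 b0 enorm_ge0.
  have := h (- (enorm b)^-1 *: b).
  rewrite enormZ normrN gtr0_norm ?invr_gt0 // mulVf ?gt_eqF // lexx.
  move=> /(_ isT); rewrite dotvZr -sqr_enorm mulNr expr2 mulKf ?gt_eqF //.
  by rewrite addrC subr_ge0.
have := cauchy_schwarz (- b) a.
rewrite dotvC -scaleN1r dotvZr enormZ normrN1 dotvC mul1r mulN1r.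
have := ler_pM (enorm_ge0 b) (enorm_ge0 a) (lexx (enorm b)) a1.
lra.
Qed.

(** * Cholesky factorization *)

Definition posdef (R : realType) n (P : 'M[R]_n) :=
  P^T = P /\ forall x : 'cV[R]_n, x != 0 -> 0 < dotv x (P *m x).

(** Induction on the size: the first column of [T] is that of [P] divided by [sqrt a], and the
    remaining block factors the Schur complement [D'] of [a]. *)
Lemma cholesky (R : realType) n (P : 'M[R]_n) : posdef P ->
  exists T : 'M[R]_n,
    [/\ P = T *m T^T, is_trig_mx T & forall i, 0 < T i i].
Proof.
elim: n P => [P _|n IH]; first by exists 0; split=> [||[]//];
  [apply/matrixP => -[]//|apply/is_trig_mxP => -[]//].
rewrite -[n.+1]/(1 + n)%N => P [Psym Ppos].
set a : R := ulsubmx P 0 0; set b := dlsubmx P; set D := drsubmx P.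
have eP : P = block_mx a%:M b^T b D.
  rewrite -[P]submxK (_ : ursubmx P = b^T) -?mx11_scalar //.
  by rewrite trmx_dlsub Psym.
have qf (s : R) (y : 'cV[R]_n) : dotv (col_mx s%:M y) (P *m col_mx s%:M y) =
    a * s ^+ 2 + 2 * s * dotv b y + dotv y (D *m y).
  rewrite /dotv {1}eP mul_block_col tr_col_mx mul_row_col.
  rewrite !mulmxDr tr_scalar_mx !mul_scalar_mx mul_mx_scalar.
  rewrite -[y^T *m (s *: b)]scalemxAr.
  have: (y^T *m b) 0 0 = (b^T *m y) 0 0 := dotvC y b.
  move: (b^T *m y) (y^T *m b) (y^T *m (D *m y)) => u v w vu.
  by rewrite !mxE eqxx mulr1n vu; ring.
have a0 : 0 < a.
  have := Ppos (col_mx 1%:M 0); rewrite qf /dotv !mulmx0 !mxE !mulr0 !addr0.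
  rewrite expr1n mulr1; apply; rewrite col_mx_eq0 negb_and.
  by apply/orP; left; apply/eqP => /matrixP /(_ 0 0) /eqP; rewrite !mxE oner_eq0.
pose D' := D - a^-1 *: (b *m b^T).
have [|T' [eD' T'trig T'pos]] := IH D'.
  split; first by rewrite linearB linearZ /= trmx_mul trmxK trmx_drsub Psym.
  (* This [s] minimizes the quadratic form of [P] at [(s, y)] for fixed [y]. The minimum is the form
     of [D'] at [y], which is therefore positive. *)
  move=> y y0; set s := - (a^-1 * dotv b y).
  have -> : dotv y (D' *m y) = a * s ^+ 2 + 2 * s * dotv b y + dotv y (D *m y).
    have -> : D' *m y = D *m y - (a^-1 * dotv b y) *: b.
      rewrite mulmxBl -scalemxAl -mulmxA [b^T *m y]mx11_scalar.
      by rewrite mul_mx_scalar scalerA.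
    rewrite dotvBr dotvZr (dotvC y b) /s; field; exact: lt0r_neq0.
  by rewrite -qf; apply: Ppos; rewrite col_mx_eq0 negb_and y0 orbT.
have sa0 : 0 < Num.sqrt a by rewrite sqrtr_gt0.
exists (block_mx (Num.sqrt a)%:M 0 ((Num.sqrt a)^-1 *: b) T'); split.
- rewrite tr_block_mx mulmx_block eP tr_scalar_mx [(_ *: b)^T]linearZ /= !trmx0.
  rewrite !mulmx0 !mul0mx !addr0 -scalar_mxM -expr2 sqr_sqrtr ?ltW //.
  rewrite mul_mx_scalar mul_scalar_mx !scalerA mulfV ?gt_eqF // !scale1r.
  rewrite -scalemxAl -scalemxAr scalerA -invfM -expr2 sqr_sqrtr ?ltW //.
  by rewrite -eD' addrC subrK.
- by rewrite is_trig_block_mx // eqxx scalar_mx_is_trig.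
- move=> i; case: (split_ordP i) => j ->.
    by rewrite block_mxEul mxE ord1 eqxx.
  by rewrite block_mxEdr.
Qed.

Lemma posdef_gram (R : realType) m n (P : 'M[R]_(m, n)) (Q : 'M[R]_(n, m)) :
  Q *m P = 1%:M -> posdef (P^T *m P).
Proof.
move=> QP; split=> [|x x0]; first by rewrite trmx_mul trmxK.
have -> : dotv x (P^T *m P *m x) = enorm (P *m x) ^+ 2.
  by rewrite sqr_enorm /dotv trmx_mul !mulmxA.
rewrite lt_def sqr_ge0 andbT sqrf_eq0 enorm_eq0.
by apply: contra_neq x0 => Px; rewrite -[x]mul1mx -QP -mulmxA Px mulmx0.
Qed.

Lemma posdef_det_gt0 (R : realType) n (P : 'M[R]_n) : posdef P -> 0 < \det P.
Proof.
move=> /cholesky[T [-> Ttrig Tpos]].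
by rewrite det_mulmx det_tr det_trig // -expr2 exprn_gt0 ?prodr_gt0.
Qed.

(** * The determinant bound *)

(** Adjoining the normalized all-one column [e] to [C] gives a square [U] with [U^T U = 1]. Hence
    [U U^T = 1] as well, that is [e e^T + C C^T = 1]. *)
Lemma frame_projector (R : realType) n (C : 'M[R]_(n.+1, n)) :
  C^T *m C = 1%:M -> C^T *m const_mx 1 = 0 :> 'cV[R]_n ->
  C *m C^T = 1%:M - const_mx n.+1%:R^-1.
Proof.
move=> CC C1; pose s : R := Num.sqrt n.+1%:R^-1.
have ss : s ^+ 2 = n.+1%:R^-1 by rewrite sqr_sqrtr // invr_ge0 ler0n.
pose e : 'cV[R]_n.+1 := const_mx s.
have eE : e = s *: const_mx 1 by apply/matrixP => i j; rewrite !mxE mulr1.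
have Ce : C^T *m e = 0 by rewrite eE -scalemxAr C1 scaler0.
have ee : e^T *m e = 1%:M.
  apply/matrixP => i j; rewrite !mxE !ord1 eqxx.
  under eq_bigr do rewrite !mxE -expr2 ss.
  by rewrite sumr_const card_ord -[LHS]mulr_natr mulVf // pnatr_eq0.
pose U : 'M[R]_(1 + n) := row_mx e C.
have : U^T *m U = 1%:M.
  rewrite tr_row_mx mul_col_row ee CC Ce.
  by rewrite -[e^T *m C]trmxK trmx_mul trmxK Ce trmx0 -scalar_mx_block.
move=> /mulmx1C; rewrite tr_row_mx mul_row_col => <-.
suff -> : e *m e^T = const_mx n.+1%:R^-1 by rewrite addrC addKr.
apply/matrixP => i j; rewrite !mxE big_ord_recl big_ord0 addr0 !mxE.
by rewrite -expr2 ss.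
Qed.

Section InscribedDet.
Variables (R : realType) (n : nat) (C : 'M[R]_(n.+1, n)).
Hypothesis n0 : (0 < n)%N.
Hypothesis CC : C^T *m C = 1%:M.
Hypothesis C1 : C^T *m const_mx 1 = 0 :> 'cV[R]_n.

(** With [N = n.+1], this is the inradius of the unit simplex: the distance from its barycenter to
    the center of a facet. *)
Local Notation t := ((Num.sqrt (n.+1 * n)%:R)^-1 : R).

Lemma radius_gt0 : 0 < t.
Proof. by rewrite invr_gt0 sqrtr_gt0 ltr0n muln_gt0. Qed.

Lemma radius_sqr : t ^+ 2 = (n.+1%:R * n%:R)^-1.
Proof. by rewrite exprVn sqr_sqrtr ?ler0n // natrM. Qed.

Lemma frame_row_norm i : enorm (row i C)^T = n%:R * t.
Proof.
have nR : n%:R != 0 :> R by rewrite pnatr_eq0 -lt0n.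
have n1R : n%:R + 1 != 0 :> R by rewrite natr1 pnatr_eq0.
apply/eqP; rewrite -(eqrXn2 (ltn0Sn 1)) ?enorm_ge0 //.
rewrite sqr_enorm dotv_row frame_projector // !mxE eqxx exprMn radius_sqr.
by apply/eqP; rewrite mulr1n -[n.+1%:R]natr1; field; rewrite nR n1R.
Qed.

Section Bound.
Variable H : 'M[R]_n.
Hypothesis H0 : \det H != 0.
Hypothesis Hsum : \sum_i enorm (row i (C *m H))^T <= 1.

Lemma posdef_HHt : posdef (H *m H^T).
Proof.
rewrite -{1}[H]trmxK; apply: (@posdef_gram _ _ _ _ (invmx H^T)).
by rewrite mulVmx // unitmxE det_tr unitfE.
Qed.

(** Equality determines [H] only up to an orthogonal factor on the right, which is all that the
    ellipsoid as a set can see. *)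
Lemma inscribed_det :
  \det H ^+ 2 <= (t ^+ 2) ^+ n /\
  (\det H ^+ 2 = (t ^+ 2) ^+ n -> H *m H^T = (t ^+ 2)%:M).
Proof.
have [T [HT Ttrig Tpos]] := cholesky posdef_HHt.
have t0 := radius_gt0.
have nR : 0 < n%:R :> R by rewrite ltr0n.
pose d i := enorm (row i (C *m T))^T.
(* The row norms of [C H] depend on [H] only through [H H^T = T T^T]. *)
have dE i : enorm (row i (C *m H))^T = d i.
  apply/eqP; rewrite -(eqrXn2 (ltn0Sn 1)) ?enorm_ge0 // !sqr_enorm !dotv_row.
  by rewrite !trmx_mul !mulmxA -(mulmxA C H) HT -!mulmxA.
pose u i := (row i C)^T.
pose v i := (row i (C *m T))^T.
(* Inserting [C^T C = 1] and using cyclicity spreads the trace over the [n.+1] rows of [C]. *)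
have trE : \tr T = \sum_i dotv (u i) (v i).
  rewrite -mxtrace_tr -[T^T]mul1mx -CC -mulmxA mxtrace_mulC.
  apply: eq_bigr => i _; rewrite dotv_row trmx_mul.
  by rewrite mulmxA.
have cs i : dotv (u i) (v i) <= n%:R * t * d i.
  by rewrite -(frame_row_norm i) cauchy_schwarz.
have trle : \tr T <= n%:R * t.
  rewrite trE; apply: le_trans (_ : \sum_i n%:R * t * d i <= _).
    exact: ler_sum.
  rewrite -mulr_sumr -[leRHS]mulr1 ler_pM2l ?mulr_gt0 //.
  by under eq_bigr do rewrite -dE.
have detH : \det H ^+ 2 = (\prod_i T i i) ^+ 2.
  by rewrite -det_trig // !expr2 -{2}(det_tr H) -det_mulmx HT det_mulmx det_tr.
(* The mean of the diagonal of [T]. The bound comes from the chain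
   [\prod_i T i i <= mu ^+ n <= t ^+ n]; the equality case squeezes both inequalities. *)
pose mu := \tr T / n%:R.
have mut : mu <= t by rewrite ler_pdivrMr // mulrC.
have mu0 : 0 <= mu by rewrite divr_ge0 ?ler0n ?sumr_ge0 // => i _; exact: ltW.
have [agm agm_eq] : \prod_i T i i <= mu ^+ n
    ?= iff [forall i in 'I_n, forall j in 'I_n, T i i == T j j].
  have := @leif_AGM R _ 'I_n (fun i => T i i) (fun i _ => ltW (Tpos i)).
  by rewrite card_ord.
have prod0 : 0 <= \prod_i T i i by apply: prodr_ge0 => i _; exact: ltW.
have mutn : mu ^+ n <= t ^+ n by rewrite lerXn2r ?nnegrE // ltW.
rewrite detH exprAC; split=> [|/eqP].
  by rewrite ler_sqr ?nnegrE ?exprn_ge0 ?(ltW t0) // (le_trans agm).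
rewrite eqrXn2 ?exprn_ge0 ?(ltW t0) // => /eqP prodE.
have mutnE : mu ^+ n = t ^+ n.
  by apply/eqP; rewrite eq_le mutn -prodE agm.
have muE : mu = t by apply/eqP; rewrite -(eqrXn2 n0) ?mutnE // ltW.
have Tdiag i : T i i = t.
  have Tii j : T j j = T i i.
    have: [forall i in 'I_n, forall j in 'I_n, T i i == T j j].
      by rewrite -agm_eq mutnE prodE.
    by move=> /forallP/(_ j)/implyP/(_ isT)/forallP/(_ i)/implyP/(_ isT)/eqP.
  rewrite -muE /mu /mxtrace (eq_bigr _ (fun j _ => Tii j)) sumr_const card_ord.
  by rewrite -[T i i *+ n]mulr_natr mulfK ?gt_eqF.
(* Since [mu = t], the trace attains its upper bound. The Cauchy-Schwarz defects are nonnegative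
   with sum at most 0, so each one vanishes. *)
have csE i : dotv (u i) (v i) = n%:R * t * d i.
  have sum0 : \sum_i (n%:R * t * d i - dotv (u i) (v i)) <= 0.
    rewrite sumrB -trE -mulr_sumr -(eq_bigr _ (fun i _ => dE i)).
    have -> : \tr T = n%:R * t by rewrite -muE /mu mulrC divfK ?gt_eqF.
    by rewrite subr_le0 -[leRHS]mulr1 ler_pM2l ?mulr_gt0.
  have ge0 j : true -> 0 <= n%:R * t * d j - dotv (u j) (v j).
    by rewrite subr_ge0.
  apply/esym/eqP; rewrite -subr_eq0; apply/eqP.
  apply: (psumr_eq0P ge0) => //; apply/eqP.
  by rewrite eq_le sum0 sumr_ge0.
have CT : C *m T = t *: C.
  apply/row_matrixP => i; apply: trmx_inj.
  have nt0 : 0 < n%:R * t by rewrite mulr_gt0.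
  have u0 : u i != 0 by rewrite -enorm_eq0 frame_row_norm gt_eqF.
  have uv : (n%:R * t) *: v i = d i *: u i.
    by rewrite -(frame_row_norm i) cauchy_schwarz_eq // csE frame_row_norm.
  suff dE' : d i = n%:R * t * t.
    rewrite linearZ /= -/(v i) linearZ /= -/(u i).
    by apply: (scalerI (lt0r_neq0 nt0)); rewrite uv dE' scalerA.
  (* The nonzero row [row i C] is a left null vector of [K], so [K] is singular. Being triangular,
     it has a zero on its diagonal, whose entries are all [n%:R * t * t - d i]. *)
  pose K := (n%:R * t) *: T - (d i)%:M.
  have Ktrig : is_trig_mx K.
    apply/is_trig_mxP => k l kl; rewrite !mxE (is_trig_mxP Ttrig) // mulr0.
    by rewrite -val_eqE /= (ltn_eqF kl) subr0.
  have uK : row i C *m K = 0.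
    rewrite mulmxBr mul_mx_scalar -scalemxAr -row_mul.
    apply: trmx_inj; rewrite linearB !linearZ /= -/(u i) -/(v i).
    by rewrite scalerN uv subrr trmx0.
  have : \det K == 0.
    apply: contraNT u0 => K0; have KU : K \in unitmx by rewrite unitmxE unitfE.
    by rewrite /u -[row i C]mulmx1 -(mulmxV KU) mulmxA uK mul0mx trmx0.
  rewrite det_trig // => /prodf_eq0[j _].
  by rewrite !mxE eqxx Tdiag subr_eq0 => /eqP.
have -> : H *m H^T = T *m T^T by [].
have -> : T = t%:M.
  by rewrite -[T]mul1mx -CC -mulmxA CT -scalemxAr CC scalemx1.
by rewrite tr_scalar_mx -scalar_mxM -expr2.
Qed.
End Bound.
End InscribedDet.

(** * The simplex and its inscribed ball *)

(** The witness consists of the last [n] columns of the Householder reflection exchanging the first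
    basis vector and the unit vector [const_mx s]. *)
Lemma frame_exists (R : realType) n : (0 < n)%N ->
  exists C : 'M[R]_(n.+1, n),
    C^T *m C = 1%:M /\ C^T *m const_mx 1 = 0 :> 'cV[R]_n.
Proof.
move=> n0; have nR : n%:R != 0 :> R by rewrite pnatr_eq0 -lt0n.
have n1R : n%:R + 1 != 0 :> R by rewrite natr1 pnatr_eq0.
pose s : R := Num.sqrt n.+1%:R^-1.
have ss : s ^+ 2 = (n%:R + 1)^-1 by rewrite sqr_sqrtr ?natr1 // invr_ge0 ler0n.
pose k := (1 + s) / n%:R.
have nk : n%:R * k = 1 + s by rewrite mulrC divfK.
pose C : 'M[R]_(1 + n, n) := col_mx (const_mx s) (1%:M - const_mx k).
have mulK p (y : 'cV[R]_p) : (const_mx k : 'M[R]_(n, p)) *m y =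
    const_mx (k * \sum_i y i 0).
  apply/matrixP => i j; rewrite !mxE ord1 mulr_sumr.
  by apply: eq_bigr => l _; rewrite mxE.
have KK : (const_mx k : 'M[R]_n) *m const_mx k = const_mx ((1 + s) * k) :> 'M[R]_n.
  apply/matrixP => i j; rewrite !mxE; under eq_bigr do rewrite !mxE.
  by rewrite sumr_const card_ord -nk -[LHS]mulr_natl mulrA.
have ssE : (const_mx s : 'rV[R]_n)^T *m const_mx s = const_mx (s ^+ 2) :> 'M[R]_n.
  by apply/matrixP => i j; rewrite !mxE big_ord_recl big_ord0 !mxE addr0.
have CT : C^T = row_mx (const_mx s) (1%:M - const_mx k).
  by rewrite tr_col_mx linearB /= trmx1 !trmx_const.
have C1 : C^T *m (const_mx 1 : 'cV[R]_(1 + n)) = 0.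
  have -> : const_mx 1 = col_mx (const_mx 1) (const_mx 1) :> 'cV[R]_(1 + n).
    by rewrite col_mx_const.
  rewrite CT mul_row_col mulmxBl mul1mx mulK.
  apply/matrixP => i j; rewrite !mxE big_ord_recl big_ord0 !mxE.
  under eq_bigr do rewrite !mxE.
  rewrite sumr_const card_ord; move: nk; lra.
exists C; split=> //; suff: C^T *m C = 1%:M by [].
rewrite CT mul_row_col -trmx_const ssE mulmxBl mul1mx mulmxBr mulmx1 KK.
apply/matrixP => i j; rewrite !mxE.
have : s ^+ 2 - k - k + (1 + s) * k = 0.
  apply: (mulfI nR); rewrite mulr0.
  have -> : n%:R * (s ^+ 2 - k - k + (1 + s) * k) =
    n%:R * s ^+ 2 + (s - 1) * (n%:R * k) by ring.
  have -> : n%:R * s ^+ 2 + (s - 1) * (n%:R * k) = (n%:R + 1) * s ^+ 2 - 1.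
    by rewrite nk; ring.
  by rewrite ss mulfV // subrr.
lra.
Qed.

Lemma simplexP (R : realType) n (x : 'cV[R]_n) :
  conv_hull (fun i : 'I_n => delta_mx i 0) x <->
  (forall i, 0 <= x i 0) /\ \sum_i x i 0 = 1.
Proof.
have E (w : 'I_n -> R) : \sum_i w i *: delta_mx i 0 = \col_i w i.
  apply/matrixP => i j; rewrite ord1 summxE (bigD1 i) //= big1 => [|k ki].
    by rewrite !mxE !eqxx mulr1 addr0.
  by rewrite !mxE eq_sym (negbTE ki) mulr0.
split=> [[w [w0 w1 ->]]|[x0 x1]].
  rewrite E; split=> [i|]; first by rewrite mxE.
  by rewrite -[RHS]w1; apply: eq_bigr => i _; rewrite mxE.
exists (fun i => x i 0); split=> //; rewrite E.
by apply/matrixP => i j; rewrite ord1 mxE.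
Qed.

Lemma conv_hull_mulmx (R : realType) m n k (A : 'M[R]_(m, n))
    (s : 'I_k -> 'cV[R]_n) :
  conv_hull (fun i => A *m s i) = [set A *m x | x in conv_hull s].
Proof.
have E (w : 'I_k -> R) : \sum_i w i *: (A *m s i) = A *m (\sum_i w i *: s i).
  by rewrite mulmx_sumr; apply: eq_bigr => i _; rewrite scalemxAr.
apply/seteqP; split=> [x [w [w0 w1 ->]]|_ [_ [w [w0 w1 ->]] <-]].
  by rewrite E; eexists => //; exists w.
by exists w; rewrite E.
Qed.

Lemma dotv1 (R : realType) n (x : 'cV[R]_n) : dotv (const_mx 1) x = \sum_i x i 0.
Proof. by rewrite dotvE; apply: eq_bigr => i _; rewrite mxE mul1r. Qed.

Lemma dotv_delta (R : realType) n (x : 'cV[R]_n) i :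
  dotv x (delta_mx i 0) = x i 0.
Proof.
rewrite dotvE (bigD1 i) //= big1 => [|j ji]; last by rewrite mxE (negbTE ji) mulr0.
by rewrite mxE !eqxx mulr1 addr0.
Qed.

Definition facet_center (R : realType) n (i : 'I_n.+1) : 'cV[R]_n.+1 :=
  n%:R^-1 *: (const_mx 1 - delta_mx i 0).

Lemma dotv_facet_center (R : realType) n (x : 'cV[R]_n.+1) i :
  dotv x (facet_center R i) = n%:R^-1 * (\sum_j x j 0 - x i 0).
Proof. by rewrite dotvZr dotvBr dotv_delta dotvC dotv1. Qed.

Lemma facet_centerE (R : realType) n (i j : 'I_n.+1) :
  facet_center R i j 0 = n%:R^-1 * (j != i)%:R.
Proof. by rewrite !mxE eqxx andbT; case: eqP; rewrite ?subrr ?subr0. Qed.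

Lemma sum_facet_center (R : realType) n (i : 'I_n.+1) : (0 < n)%N ->
  \sum_j facet_center R i j 0 = 1.
Proof.
move=> n0; rewrite -dotv1 dotv_facet_center mxE.
under eq_bigr do rewrite mxE.
rewrite sumr_const card_ord -natr1 addrK mulVf //.
by rewrite pnatr_eq0 -lt0n.
Qed.

Lemma facet_center_norm (R : realType) n (i : 'I_n.+1) : (0 < n)%N ->
  dotv (facet_center R i) (facet_center R i) = n%:R^-1.
Proof.
move=> n0.
rewrite dotv_facet_center sum_facet_center // facet_centerE eqxx mulr0.
by rewrite subr0 mulr1.
Qed.

(* Writing [q] for the facet centre, [|x|^2 = |x - q|^2 + 1/n - 2 x_i / n]. *)
Lemma insphere_simplex (R : realType) n (x : 'cV[R]_n.+1) i : (0 < n)%N ->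
  \sum_j x j 0 = 1 -> dotv x x <= n%:R^-1 -> x i 0 <= 0 ->
  x = facet_center R i.
Proof.
move=> n0 x1 xx xi.
have nR : 0 < n%:R^-1 :> R by rewrite invr_gt0 ltr0n.
apply/eqP; rewrite -subr_eq0 -enorm_eq0 -sqrf_eq0 eq_le sqr_ge0 andbT.
rewrite sqr_enorm dotvBr ![dotv (_ - _) _]dotvC !dotvBr facet_center_norm //.
rewrite (dotvC _ x) dotv_facet_center x1.
have := mulr_ge0_le0 (ltW nR) xi; lra.
Qed.

Lemma insphere_simplex_ge0 (R : realType) n (x : 'cV[R]_n.+1) i : (0 < n)%N ->
  \sum_j x j 0 = 1 -> dotv x x <= n%:R^-1 -> 0 <= x i 0.
Proof.
move=> n0 x1 xx; rewrite leNgt; apply/negP => xi.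
move: (xi); rewrite (insphere_simplex n0 x1 xx (ltW xi)) facet_centerE eqxx.
by rewrite mulr0 ltxx.
Qed.

(** The supremum need not be attained, but some admissible [r] exceeds [c], and that strict
    inequality is what the contact points need. *)
Lemma purity_level_gt (R : realType) N L (s : 'I_L -> 'cV[R]_N) c : 0 <= c ->
  c < purity_level s ->
  exists2 r, c < r & forall x : 'cV[R]_N,
    (forall i, 0 <= x i 0) -> \sum_i x i 0 = 1 ->
    enorm x <= r -> conv_hull s x.
Proof.
rewrite /purity_level; set E := (X in sup X) => c0 cE.
have E0 : E !=set0.
  (* The default value of [sup] on the empty set is 0, which [0 <= c < sup E] rules out. *)
  by apply/set0P; apply: contraTneq cE => ->; rewrite sup0 -leNgt.
have [r [_ rE] cr] := sup_gt E0 cE.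
have r0 : 0 < r by apply: le_lt_trans cr.
exists r => // x x0 x1 xr; apply: rE; split; first exact/simplexP.
exists (r^-1 *: x); last by rewrite scalerA mulfV ?gt_eqF // scale1r.
by rewrite /unit_ball /= enormZ gtr0_norm ?invr_gt0 // ler_pdivrMl // mulr1.
Qed.

(** * Ellipsoids and contact points *)

Lemma ellipsoid_mulmx (R : realType) m n p (A : 'M[R]_(m, n)) (F : 'M[R]_(n, p))
    (c : 'cV[R]_n) :
  ellipsoid (A *m F) (A *m c) = [set A *m x | x in ellipsoid F c].
Proof.
apply/seteqP; split=> [_ [a a1 <-]|_ [_ [a a1 <-] <-]].
  by exists (F *m a + c); [exists a|rewrite mulmxDr mulmxA].
by exists a => //; rewrite mulmxDr mulmxA.
Qed.

Lemma det_gram_mul (R : realType) m n (D : 'M[R]_(m, n)) (H : 'M[R]_n) :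
  \det ((D *m H)^T *m (D *m H)) = \det H ^+ 2 * \det (D^T *m D).
Proof.
rewrite trmx_mul !mulmxA -(mulmxA H^T) !det_mulmx det_tr; ring.
Qed.

Lemma ellipsoid_mul_orthogonal (R : realType) m n (F : 'M[R]_(m, n)) (Q : 'M[R]_n)
    (c : 'cV[R]_m) : Q *m Q^T = 1%:M -> ellipsoid (F *m Q) c = ellipsoid F c.
Proof.
move=> QQ; have iso (P : 'M[R]_n) (a : 'cV[R]_n) : P^T *m P = 1%:M ->
    unit_ball a -> unit_ball (P *m a).
  move=> PP; rewrite /unit_ball /= !enorm_le // /dotv trmx_mul.
  by rewrite mulmxA -(mulmxA a^T) PP mulmx1.
apply/seteqP; split=> [_ [a a1 <-]|_ [a a1 <-]].
  by exists (Q *m a); [apply: iso => //; exact: mulmx1C|rewrite mulmxA].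
exists (Q^T *m a); first by apply: iso => //; rewrite trmxK.
by rewrite !mulmxA -(mulmxA F) QQ mulmx1.
Qed.

Lemma col_matrix_inj (R : realType) m n (P Q : 'M[R]_(m, n)) :
  (forall j, col j P = col j Q) -> P = Q.
Proof.
by move=> e; apply/matrixP => i j; move/matrixP/(_ i 0): (e j); rewrite !mxE.
Qed.

Lemma mulmx_entry_continuous (R : realType) m n p (B : 'M[R]_(m, n)) i j :
  continuous (fun y : 'M[R]_(n, p) => (B *m y) i j).
Proof.
rewrite (_ : (fun y => _) = fun y : 'M[R]_(n, p) => \sum_k B i k * y k j);
  last by apply/funext => y; rewrite mxE.
apply: continuous_big => [|k _ y]; first exact: add_continuous.
by apply: continuousM; [exact: cst_continuous | exact: coord_continuous].
Qed.

Lemma dotv_mulmx_continuous (R : realType) m n (B : 'M[R]_(m, n)) :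
  continuous (fun y : 'cV[R]_n => dotv (B *m y) (B *m y)).
Proof.
rewrite (_ : (fun y => _) =
    fun y : 'cV[R]_n => \sum_k (B *m y) k 0 * (B *m y) k 0);
  last by apply/funext => y; rewrite dotvE.
apply: continuous_big => [|k _ y]; first exact: add_continuous.
by apply: continuousM; apply: mulmx_entry_continuous.
Qed.

(** * Ellipsoids inside the image of the simplex under an injective linear map *)

Section SimplexImage.
Variables (R : realType) (n M : nat).
Variables (C : 'M[R]_(n.+1, n)) (A : 'M[R]_(M, n.+1)) (B : 'M[R]_(n.+1, M)).
Hypothesis n0 : (0 < n)%N.
Hypothesis CC : C^T *m C = 1%:M.
Hypothesis C1 : C^T *m const_mx 1 = 0 :> 'cV[R]_n.
Hypothesis BA : B *m A = 1%:M.

Local Notation t := ((Num.sqrt (n.+1 * n)%:R)^-1 : R).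
Local Notation center := (const_mx n.+1%:R^-1 : 'cV[R]_n.+1).

Lemma dotv_const (x : 'cV[R]_n.+1) k : dotv x (const_mx k) = k * \sum_i x i 0.
Proof. by rewrite dotvE mulr_sumr; apply: eq_bigr => i _; rewrite mxE mulrC. Qed.

Lemma sum_center : \sum_i center i 0 = 1.
Proof.
under eq_bigr do rewrite mxE.
by rewrite sumr_const card_ord -[LHS]mulr_natr mulVf // pnatr_eq0.
Qed.

Lemma sum_frame (a : 'cV[R]_n) : \sum_i (C *m a) i 0 = 0.
Proof.
by rewrite -dotv1 /dotv mulmxA -[C]trmxK -trmx_mul C1 trmx0 mul0mx mxE.
Qed.

Lemma frame_projM (x : 'cV[R]_n.+1) :
  C *m (C^T *m x) = x - (\sum_i x i 0) *: center.
Proof.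
rewrite mulmxA frame_projector // mulmxBl mul1mx; congr (_ - _).
apply/matrixP => i j; rewrite !mxE ord1 mulr_suml.
by apply: eq_bigr => k _; rewrite mxE mulrC.
Qed.

(** By Pythagoras, [|x|^2 = |x - center|^2 + 1/N] on the hyperplane of sum 1, and [t^2 + 1/N = 1/n].
    Measuring from the origin makes the ellipsoid comparable with the purity ball. *)
Lemma insphereP (x : 'cV[R]_n.+1) :
  ellipsoid (t *: C) center x <->
  \sum_i x i 0 = 1 /\ dotv x x <= n%:R^-1.
Proof.
have nR : n%:R != 0 :> R by rewrite pnatr_eq0 -lt0n.
have n1R : n%:R + 1 != 0 :> R by rewrite natr1 pnatr_eq0.
have t0 : 0 < t := radius_gt0 R n0.
have xE : \sum_i x i 0 = 1 -> x = (t *: C) *m (t^-1 *: (C^T *m x)) + center.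
  move=> x1; rewrite -scalemxAl -scalemxAr scalerA mulfV ?gt_eqF // scale1r.
  by rewrite frame_projM x1 scale1r subrK.
have xn : \sum_i x i 0 = 1 ->
    (enorm (t^-1 *: (C^T *m x)) <= 1) = (dotv x x <= n%:R^-1).
  move=> x1; rewrite enorm_le ?ler01 // expr1n dotvZr dotvC dotvZr mulrA -expr2.
  have -> : dotv (C^T *m x) (C^T *m x) = dotv x (C *m (C^T *m x)).
    by rewrite /dotv trmx_mul trmxK !mulmxA.
  rewrite frame_projM x1 scale1r dotvBr dotv_const x1 mulr1.
  rewrite exprVn (radius_sqr R n) invrK -[n.+1%:R]natr1.
  rewrite -ler_pdivlMl; last by rewrite mulr_gt0 ?natr1 ?ltr0n.
  by rewrite mulr1 lerBlDr; congr (_ <= _); field; rewrite nR n1R.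
split=> [[a a1 xa]|[x1 xx]]; last first.
  by exists (t^-1 *: (C^T *m x)); [rewrite /unit_ball /= xn|rewrite -xE].
have x1 : \sum_i x i 0 = 1.
  rewrite -xa; under eq_bigr do rewrite mxE.
  rewrite big_split /= sum_center -scalemxAl.
  by rewrite scalemxAr sum_frame add0r.
split=> //; rewrite -xn // -xa mulmxDr.
have -> : C^T *m center = 0.
  have -> : center = n.+1%:R^-1 *: const_mx 1.
    by apply/matrixP => i j; rewrite !mxE mulr1.
  by rewrite -scalemxAr C1 scaler0.
rewrite addr0 -scalemxAl -scalemxAr mulmxA CC mul1mx scalerA.
by rewrite mulVf ?gt_eqF // scale1r.
Qed.

(** In the coordinates given by [B], the points of the ellipsoid and its center have sum 1, so the
    columns of [B F] have sum 0 and are fixed by [C C^T]. This provides [H = C^T B F]. *)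
Lemma ellipsoid_in_simplex_image (F : 'M[R]_(M, n)) (c : 'cV[R]_M) :
  ellipsoid F c `<=`
    [set A *m x | x in conv_hull (fun i : 'I_n.+1 => delta_mx i 0)] ->
  exists (H : 'M[R]_n) (d : 'cV[R]_n.+1),
    [/\ F = A *m C *m H, c = A *m d, \sum_i d i 0 = 1
      & forall i, enorm (row i (C *m H))^T <= d i 0].
Proof.
move=> sub.
have inE a : enorm a <= 1 -> exists x : 'cV[R]_n.+1,
    [/\ F *m a + c = A *m x, x = B *m (F *m a + c),
      forall i, 0 <= x i 0 & \sum_i x i 0 = 1].
  move=> a1; have [|x /simplexP[x0 x1] xE] := sub (F *m a + c); first by exists a.
  by exists x; split=> //; rewrite -xE mulmxA BA mul1mx.
pose d := B *m c.
have [|d' [cE dE _ d1]] := inE 0; first by rewrite enorm0 ler01.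
rewrite mulmx0 add0r in cE dE; rewrite -/d in dE; subst d'.
have GE a : enorm a <= 1 -> [/\ F *m a = A *m (B *m F *m a),
    \sum_i (B *m F *m a) i 0 = 0 & forall i, 0 <= (B *m F *m a) i 0 + d i 0].
  move=> /inE[x [xE xE' x0 x1]].
  have xd : B *m F *m a = x - d by rewrite xE' mulmxDr mulmxA addrK.
  rewrite xd mulmxBr -xE -cE addrK; split=> // [|i].
    by rewrite -dotv1 dotvBr !dotv1 x1 d1 subrr.
  by rewrite !mxE subrK.
have CCG : C *m (C^T *m (B *m F)) = B *m F.
  apply: col_matrix_inj => j; rewrite !colE -!mulmxA frame_projM mulmxA.
  have [|_ -> _] := GE (delta_mx j 0); first by rewrite enorm_delta.
  by rewrite scale0r subr0.
have AE : F = A *m C *m (C^T *m (B *m F)).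
  rewrite -mulmxA CCG; apply: col_matrix_inj => j; rewrite !colE -(mulmxA A).
  by have [|e _ _] := GE (delta_mx j 0); first by rewrite enorm_delta.
exists (C^T *m (B *m F)), d; split=> // i.
(* The norm bound on row [i] is exactly nonnegativity of coordinate [i] over the whole ellipsoid. *)
apply/linear_ge0_unit_ball => a a1; rewrite CCG.
have [_ _ /(_ i)] := GE a a1.
by rewrite /dotv trmxK -row_mul [row _ _ _ _]mxE.
Qed.

(** * Feasibility, optimality and uniqueness *)

Local Notation Fstar := (t *: (A *m C)).

(** [K] stands for the convex hull of the columns of [S]: it lies in the simplex and contains the
    part of the simplex of norm at most [r]. *)
Variable K : set 'cV[R]_n.+1.
Hypothesis K_ge0 : forall x, K x -> forall i, 0 <= x i 0.
Hypothesis K_sum : forall x, K x -> \sum_i x i 0 = 1.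
Variable r : R.
Hypothesis r_gt : 1 / Num.sqrt n%:R < r.
Hypothesis K_ball : forall x : 'cV[R]_n.+1,
  (forall i, 0 <= x i 0) -> \sum_i x i 0 = 1 -> enorm x <= r -> K x.

Local Notation X := [set A *m x | x in K].

Lemma purity_gt0 : 0 < r.
Proof. by apply: le_lt_trans r_gt; rewrite divr_ge0 ?sqrtr_ge0. Qed.

Lemma purity_sqr : n%:R^-1 < r ^+ 2.
Proof.
have <- : (1 / Num.sqrt n%:R) ^+ 2 = n%:R^-1 :> R.
  by rewrite div1r exprVn sqr_sqrtr ?ler0n.
by rewrite ltr_sqr ?nnegrE ?(ltW purity_gt0) // divr_ge0 ?sqrtr_ge0.
Qed.

Lemma star_ellipsoid :
  ellipsoid Fstar (A *m center) = [set A *m x | x in ellipsoid (t *: C) center].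
Proof. by rewrite -ellipsoid_mulmx -scalemxAr. Qed.

Lemma insphere_subset x : ellipsoid (t *: C) center x -> K x.
Proof.
move=> /insphereP[x1 xx]; apply: K_ball => // [i|].
  exact: insphere_simplex_ge0.
by rewrite enorm_le ?(ltW purity_gt0) // (le_trans xx) // ltW // purity_sqr.
Qed.

Lemma star_feasible : ellipsoid Fstar (A *m center) `<=` X.
Proof.
by rewrite star_ellipsoid => _ [x xE <-]; exists x => //; exact: insphere_subset.
Qed.

Lemma gram_gt0 : 0 < \det ((A *m C)^T *m (A *m C)).
Proof.
apply/posdef_det_gt0/(@posdef_gram _ _ _ _ (C^T *m B)).
by rewrite -mulmxA (mulmxA B) BA mul1mx.
Qed.

Lemma det_gram_star :
  \det (Fstar^T *m Fstar) = (t ^+ 2) ^+ n * \det ((A *m C)^T *m (A *m C)).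
Proof.
by rewrite -mul_mx_scalar det_gram_mul det_scalar exprAC.
Qed.

(** As [K] lies in the simplex, [F = A C H]. Its Gram determinant is [\det H ^+ 2] times a positive
    constant depending on [A] and [C], which reduces the claim to [inscribed_det]. *)
Lemma feasible_bound (F : 'M[R]_(M, n)) (c : 'cV[R]_M) : ellipsoid F c `<=` X ->
  \det (F^T *m F) <= \det (Fstar^T *m Fstar) /\
  (\det (F^T *m F) = \det (Fstar^T *m Fstar) ->
   ellipsoid F c = ellipsoid Fstar (A *m center)).
Proof.
move=> sub; have [|H [d [-> -> d1 Hd]]] := @ellipsoid_in_simplex_image F c.
  apply: (subset_trans sub) => _ [x Kx <-]; exists x => //.
  by apply/simplexP; split; [exact: K_ge0|exact: K_sum].
rewrite det_gram_star det_gram_mul ler_pM2r ?gram_gt0 //.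
(* A degenerate ellipsoid has determinant 0, strictly below the optimum, so equality cannot
   occur. *)
have [H0|H0] := eqVneq (\det H) 0.
  have t2n : 0 < (t ^+ 2) ^+ n by rewrite !exprn_gt0 // radius_gt0.
  rewrite H0 expr0n mul0r ltW //; split=> // /esym /eqP.
  by rewrite mulf_eq0 !gt_eqF // gram_gt0.
have Hsum : \sum_i enorm (row i (C *m H))^T <= 1.
  by rewrite -d1; apply: ler_sum.
have [bnd eqc] := inscribed_det n0 CC C1 H0 Hsum.
split=> // /(mulIf (lt0r_neq0 gram_gt0)) /eqc HH.
have t0 := radius_gt0 R n0.
(* From [H H^T = t^2], each row norm is [t * (n t) = 1/N]. Thus every [d i 0] is at least [1/N], and
   the sum 1 forces [d] to be the barycenter. *)
have Hrow i : enorm (row i (C *m H))^T = n.+1%:R^-1.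
  apply/eqP; rewrite -(eqrXn2 (ltn0Sn 1)) ?enorm_ge0 ?invr_ge0 ?ler0n //.
  rewrite sqr_enorm dotv_row trmx_mul mulmxA -(mulmxA C) HH mul_mx_scalar.
  rewrite -scalemxAl mxE -dotv_row -sqr_enorm frame_row_norm //.
  have nR : n%:R != 0 :> R by rewrite pnatr_eq0 -lt0n.
  have n1R : n%:R + 1 != 0 :> R by rewrite natr1 pnatr_eq0.
  rewrite exprMn radius_sqr -[n.+1%:R]natr1; apply/eqP; field; by rewrite nR n1R.
have dE : d = center.
  have ge0 i : true -> 0 <= d i 0 - n.+1%:R^-1 by rewrite subr_ge0 -(Hrow i).
  apply/matrixP => i j; rewrite ord1 mxE; apply/eqP; rewrite -subr_eq0; apply/eqP.
  apply: (psumr_eq0P ge0) => //.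
  rewrite sumrB d1 sumr_const card_ord -[X in _ - X]mulr_natr.
  by rewrite mulVf ?subrr ?pnatr_eq0.
have -> : A *m C *m H = Fstar *m (t^-1 *: H).
  by rewrite -scalemxAl -scalemxAr scalerA mulfV ?gt_eqF // scale1r.
rewrite dE; apply: ellipsoid_mul_orthogonal.
rewrite linearZ /= -scalemxAl -scalemxAr HH scalerA scale_scalar_mx.
by rewrite -invfM -expr2 mulVf // gt_eqF // exprn_gt0.
Qed.

(** * Relative interior and contact points *)

Lemma insphere_image x : ellipsoid (t *: C) center x -> X (A *m x).
Proof. by move=> xE; exists x => //; apply: insphere_subset xE. Qed.

(** Both properties hold on [X] and pass to affine combinations, so [B] serves as a coordinate map
    on the whole affine hull. *)
Lemma aff_hull_image (y : 'cV[R]_M) : aff_hull X y ->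
  y = A *m (B *m y) /\ \sum_i (B *m y) i 0 = 1.
Proof.
move=> [k [z [w [zX w1 ->]]]].
have zE j : A *m (B *m z j) = z j /\ dotv (const_mx 1) (B *m z j) = 1.
  have [x Kx <-] := zX j.
  by rewrite (mulmxA B) BA mul1mx dotv1; split=> //; exact: K_sum.
split.
  rewrite !mulmx_sumr; apply: eq_bigr => j _.
  by rewrite -!scalemxAr (zE j).1.
rewrite -dotv1 /dotv !mulmx_sumr summxE -[RHS]w1; apply: eq_bigr => j _.
by rewrite -!scalemxAr mxE -/(dotv _ _) (zE j).2 mulr1.
Qed.

(** Positivity of the coordinates [B y] and the bound [r] on their norm are strict, hence persist
    near [A *m x]. On the affine hull, [y = A (B y)] then lies in [X]. *)
Lemma relint_image (x : 'cV[R]_n.+1) :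
  (forall i, 0 < x i 0) -> \sum_i x i 0 = 1 -> enorm x < r -> relint X (A *m x).
Proof.
move=> x0 x1 xr; split.
  by exists x => //; apply: K_ball => // [i|]; exact: ltW.
have BAx : B *m (A *m x) = x by rewrite mulmxA BA mul1mx.
have near_pos : \forall y \near A *m x, forall i, 0 < (B *m y) i 0.
  apply: (@filter_forall _ _ _ (nbhs (A *m x))) => i.
  have := @mulmx_entry_continuous R _ _ 1 B i 0 (A *m x).
  by move=> /cvgr_gt; apply; rewrite BAx.
have near_r : \forall y \near A *m x, dotv (B *m y) (B *m y) < r ^+ 2.
  have := @dotv_mulmx_continuous R _ _ B (A *m x).
  move=> /cvgr_lt; apply; rewrite BAx -sqr_enorm.
  by rewrite ltr_sqr ?nnegrE ?enorm_ge0 ?(ltW (purity_gt0)).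
rewrite /within /=; near=> y => /aff_hull_image[yE y1].
rewrite /= yE; exists (B *m y) => //; apply: K_ball => // [i|].
  by apply: ltW; move: i; near: y.
rewrite enorm_le ?(ltW (purity_gt0)) //; apply: ltW.
by near: y.
Unshelve. all: by end_near. Qed.

Lemma facet_center_insphere i : ellipsoid (t *: C) center (facet_center R i).
Proof.
apply/insphereP.
by rewrite sum_facet_center // facet_center_norm.
Qed.

Lemma center_insphere : ellipsoid (t *: C) center center.
Proof. by exists 0; [rewrite /unit_ball /= enorm0 ler01|rewrite mulmx0 add0r]. Qed.

(* Prolonging the segment from the centre through the facet centre leaves the
   half-space [x_i >= 0], but not the affine hull. *)
Lemma facet_center_not_relint i : ~ relint X (A *m facet_center R i).
Proof.
set q := facet_center R i => -[_ Hq].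
pose f (e : R) := A *m q + e *: (A *m (q - center)).
have fc : f e @[e --> 0] --> A *m q.
  have : f e @[e --> 0] --> A *m q + 0 *: (A *m (q - center)).
    by apply: cvgD; [exact: cvg_cst|apply: cvgZ; [exact: cvg_id|exact: cvg_cst]].
  by rewrite scale0r addr0.
have /nbhs_ballP[e /= e0 he] := fc _ Hq.
have e2 : 0 < e / 2 by rewrite divr_gt0.
have : X (f (e / 2)).
  apply: he.
    rewrite /ball /= sub0r normrN gtr0_norm // ltr_pdivrMr //.
    by rewrite mulr_natr mulr2n ltrDl.
  (* The prolonged point is the affine combination of [q] and the center with weights [1 + e/2] and
     [-e/2]; its coordinate [i] is [-(e/2)/N]. *)
  exists 2%N, (fun k => if k == 0 then A *m q else A *m center),
    (fun k => if k == 0 then 1 + e / 2 else - (e / 2)); split.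
  - move=> k; case: ifP => _; apply: insphere_image.
      exact: facet_center_insphere.
    exact: center_insphere.
  - by rewrite big_ord_recl big_ord1 /= addrK.
  - rewrite big_ord_recl big_ord1 /= /f mulmxBr scalerBr scalerDl scale1r scaleNr.
    by rewrite addrA.
move=> [x Kx xf]; have := K_ge0 Kx i.
have -> : x = q + (e / 2) *: (q - center).
  by rewrite -[x]mul1mx -BA -mulmxA xf /f scalemxAr -mulmxDr mulmxA BA mul1mx.
have qi : q i 0 = 0 by rewrite /q facet_centerE eqxx mulr0.
have -> : (q + (e / 2) *: (q - center)) i 0 =
    q i 0 + (e / 2) * (q i 0 - n.+1%:R^-1) by rewrite !mxE.
rewrite qi add0r sub0r mulrN oppr_ge0 leNgt => /negP; apply.
by rewrite mulr_gt0 ?invr_gt0 ?ltr0n.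
Qed.

Lemma contact_points :
  ellipsoid Fstar (A *m center) `&` rbd X =
  range (fun i : 'I_n.+1 => A *m facet_center R i).
Proof.
rewrite star_ellipsoid; apply/seteqP; split=> [_ [[x xE <-] [_ nrel]]|_ [i _ <-]].
  have [x1 xx] := (insphereP x).1 xE.
  (* A nonpositive coordinate forces [x] to be a facet center. Otherwise all coordinates are
     positive and the norm is below [r], so the image is in the relative interior. *)
  have [[i xi]|pos] := pselect (exists i, x i 0 <= 0).
    by exists i => //; rewrite (insphere_simplex n0 x1 xx xi).
  case: nrel; apply: relint_image => // [i|].
    by rewrite ltNge; apply/negP => xi; apply: pos; exists i.
  rewrite -ltr_sqr ?nnegrE ?enorm_ge0 ?(ltW (purity_gt0)) // sqr_enorm.
  exact: le_lt_trans xx (purity_sqr).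
split; first by exists (facet_center R i) => //; exact: facet_center_insphere.
split; last exact: facet_center_not_relint.
apply: subset_closure; apply: insphere_image; exact: facet_center_insphere.
Qed.
End SimplexImage.

(** * Assembling the theorem *)

Lemma mulmx_sum_col (R : realType) m n (A : 'M[R]_(m, n)) (x : 'cV[R]_n) :
  A *m x = \sum_i x i 0 *: col i A.
Proof.
apply/matrixP => i j; rewrite ord1 !mxE summxE; apply: eq_bigr => k _.
by rewrite !mxE mulrC.
Qed.

Theorem theorem3 (R : realType) (M N L : nat)
    (A : 'M[R]_(M, N)) (S : 'M[R]_(N, L))
    (hNML : (N <= minn M L)%N)
    (hA1 : forall i : 'I_L,
      (forall j : 'I_N, 0 <= col i S j 0) /\ \sum_(j < N) col i S j 0 = 1)
    (hA2 : \rank A = N)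
    (hA3 : \rank S = N)
    (hN : (3 <= N)%N)
    (hgamma : 1 / Num.sqrt N.-1%:R < purity_level (fun i : 'I_L => col i S)) :
  let X : set 'cV[R]_M := conv_hull (fun i : 'I_L => A *m col i S) in
  let abar : 'cV[R]_M := N%:R^-1 *: \sum_(i < N) col i A in
  let q (i : 'I_N) : 'cV[R]_M := N.-1%:R^-1 *: \sum_(j < N | j != i) col j A in
  let admissible (C : 'M[R]_(N, N.-1)) : Prop :=
    C^T *m C = 1%:M /\ C^T *m const_mx 1 = 0 :> 'cV[R]_N.-1 in
  (exists C, admissible C) /\
  forall C, admissible C ->
    let Fstar : 'M[R]_(M, N.-1) := (Num.sqrt (N * N.-1)%:R)^-1 *: (A *m C) in
    let Estar := ellipsoid Fstar abar in
    [/\ mvie_optimal X Fstar abar,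
        forall (F : 'M[R]_(M, N.-1)) (c : 'cV[R]_M),
          mvie_optimal X F c -> ellipsoid F c = Estar,
        Estar `&` rbd X = range q
      & injective q].
Proof.
(* Writing [N] as [n.+1] makes [N.-1] compute to [n], matching the section above. *)
case: N A S hNML hA1 hA2 hA3 hN hgamma => [//|n] A S _ hA1 hA2 _ hN hgamma.
rewrite /= in hgamma.
have n0 : (0 < n)%N by rewrite -ltnS (leq_trans _ hN).
move=> X abar q admissible.
(* Full column rank of [A] is [row_full], whose characterization supplies a left inverse. *)
have [B BA] : exists B, B *m A = 1%:M by apply/row_fullP; rewrite /row_full hA2.
have abarE : abar = A *m const_mx n.+1%:R^-1.
  rewrite mulmx_sum_col /abar scaler_sumr.
  by apply: eq_bigr => i _; rewrite mxE.
have qE i : q i = A *m facet_center R i.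
  rewrite mulmx_sum_col /q /= scaler_sumr big_mkcond /=.
  apply: eq_bigr => j _; rewrite facet_centerE.
  by case: (j != i); rewrite ?mulr1 // mulr0 scale0r.
pose K := conv_hull (fun i => col i S).
have XE : X = [set A *m x | x in K] by exact: conv_hull_mulmx.
have K_ge0 x : K x -> forall i, 0 <= x i 0.
  move=> [w [w0 _ ->]] i; rewrite summxE sumr_ge0 // => j _.
  by rewrite mxE mulr_ge0 // (hA1 j).1.
have K_sum x : K x -> \sum_i x i 0 = 1.
  move=> [w [_ w1 ->]]; rewrite -dotv1 /dotv mulmx_sumr summxE -[RHS]w1.
  apply: eq_bigr => j _.
  by rewrite -scalemxAr mxE -/(dotv _ _) dotv1 (hA1 j).2 mulr1.
have [|r r_gt K_ball] := purity_level_gt _ hgamma.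
  by rewrite divr_ge0 ?sqrtr_ge0.
split; first exact: frame_exists.
move=> C [CC C1] Fstar Estar.
have feas : ellipsoid Fstar abar `<=` X.
  by rewrite XE abarE; apply: (star_feasible n0 CC C1 r_gt K_ball).
have bound (F : 'M[R]_(M, n)) (c : 'cV[R]_M) : ellipsoid F c `<=` X ->
    \det (F^T *m F) <= \det (Fstar^T *m Fstar) /\
    (\det (F^T *m F) = \det (Fstar^T *m Fstar) -> ellipsoid F c = Estar).
  by rewrite XE /Estar abarE; apply: (feasible_bound n0 CC C1 BA K_ge0 K_sum).
split.
- by split=> // F' c' /bound[].
- move=> F c [Fsub Fmax]; have [Fle Feq] := bound F c Fsub.
  by apply: Feq; apply/eqP; rewrite eq_le Fle (Fmax Fstar abar).
- rewrite XE /Estar abarE (contact_points n0 CC C1 BA K_ge0 K_sum r_gt K_ball).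
  by rewrite (_ : q = fun i => A *m facet_center R i) //; apply/funext.
- move=> i j; rewrite !qE => /(congr1 (mulmx B)); rewrite !mulmxA BA !mul1mx.
  (* Coordinate [i] tells the facet centers apart: it is 0 for index [i] and [1/n] for any other
     index. *)
  move=> /matrixP /(_ i 0) /eqP; rewrite !facet_centerE eqxx mulr0.
  case: (eqVneq i j) => //= _; rewrite mulr1 eq_sym invr_eq0 pnatr_eq0.
  by rewrite eqn0Ngt n0.
Qed.
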